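(* Let $\mathcal X$ be an open subset of $\mathbb R^p$ with its Borel $\sigma$-field, let $\Theta \subseteq \mathbb R^d$, $\theta_0 \in \Theta$, and let $\{\mu_\theta\}_{\theta\in\Theta}$ be a differentiable path of probability measures on $\mathcal X$ with $\mu_{\theta_0} = \mu$, i.e. a family that is differentiable in $\mathbb L^2(\mu)$ at $\theta_0$, with score $g$ and invertible Fisher information matrix $\mathcal I = \int_{\mathcal X} g g^t\, d\mu$. Let $\psi : \{\mu_\theta\}_{\theta\in\Theta} \to \mathbb R$ be a map such that $\theta \mapsto \psi(\mu_\theta)$ is differentiable at $\theta_0$, with derivative $\dot\psi(\theta_0) \in \mathbb R^{d}$ (column vector). Let $B_\psi(\{\mu_\theta\}_\theta) = \dot\psi(\theta_0)^t\, \mathcal I^{-1}\, \dot\psi(\theta_0)$ be the Cramér-Rao bound. Then for all $n \in \mathbb N$ ($n\ge 1$), $$ B_\psi(\{\mu_\theta\}_\theta) = \lim_{\theta\to\theta_0} H_\psi^n(\mu,\mu_\theta). $$ In particular, $$ B_\psi^n(\{\mu_\theta\}_\theta) \geq B_\psi(\{\mu_\theta\}_\theta). $$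
   Context: The quadratic divergence of a probability measure $\nu$ with respect to a probability measure $\mu$ on $\mathcal X$ is $$ d(\mu,\nu) = \int_{\mathcal X} \left(1 - \frac{d\nu}{d\mu}\right)^2 d\mu \ \text{ if } \nu \ll \mu, \qquad d(\mu,\nu) = +\infty \ \text{ otherwise}. $$ For a model (set of probability measures) $\mathcal P \ni \mu$ on which a real-valued parameter $\psi$ is defined, for $\nu \in \mathcal P\setminus\{\mu\}$ and an integer $n\ge 1$ (the sample size), $$ H_\psi^n(\mu,\nu) = n\,\frac{(\psi(\mu)-\psi(\nu))^2}{(d(\mu,\nu)+1)^n - 1}, $$ with the convention $1/\infty = 0$, and $$ B_\psi^n(\mathcal P) = \sup_{\nu \in \mathcal P \setminus\{\mu\}} H_\psi^n(\mu,\nu). $$ The family $\{\mu_\theta\}_{\theta\in\Theta}$, $\Theta\subseteq\mathbb R^d$, with $\mu_{\theta_0}=\mu$, is differentiable in $\mathbb L^2(\mu)$ at $\theta_0$ if there is a map $g:\mathcal X\to\mathbb R^d$ with $\int_{\mathcal X} g^t g\, d\mu<\infty$ such that for all $a \in \mathbb R^d$, $$ \lim_{t\to 0} \int_{\mathcal X} \left[ \frac1t\left(\frac{d\mu_{\theta_0+ta}}{d\mu}(x) - 1\right) - a^t g(x)\right]^2 d\mu(x) = 0 . $$ The function $g$ is called the score function of the model at $\theta_0$, and $\mathcal I = \int_{\mathcal X} g g^t\, d\mu$ is the Fisher information.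
   Formalization: For d≥2 the unrestricted limit is false (N(θ,I₂), ψ=θ₁: B=1 but H=0 on the axis θ₁=0). Proved instead: the full limit for d=1; for d≥1 the limit along each line through θ₀ exists, is ≤ B, and equals B for some direction. Bⁿ≥B is proved for all d≥1. *)

(* Defs.v *)
From HB Require Import structures.
From mathcomp Require Import all_boot all_order all_algebra.
From mathcomp Require Import all_classical all_reals all_analysis.

Set Implicit Arguments.
Unset Strict Implicit.
Unset Printing Implicit Defensive.

Import Order.TTheory GRing.Theory Num.Theory.
Import numFieldNormedType.Exports.

Local Open Scope classical_set_scope.
Local Open Scope ring_scope.
Local Open Scope charge_scope.

(* A subset X of a topological space, with the subspace topology and its Borel
   sigma-field.  The point x0 is there only because measurable types are
   pointed; a space that carries a probability measure is nonempty. *)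
Section borel_subspace.
Context {T : topologicalType} {X : set T}.

Definition pointed_subspace (x0 : X) : Type := X.

HB.instance Definition _ (x0 : X) := Choice.on (pointed_subspace x0).
HB.instance Definition _ (x0 : X) := isPointed.Build (pointed_subspace x0) x0.

End borel_subspace.

Notation borel_subspace X x0 :=
  (@g_sigma_algebraType (@pointed_subspace _ X x0) (@open (set_type X))).

Section divergence_bound.
Context {disp : measure_display} {T : measurableType disp} {R : realType}.
Implicit Types mu nu : probability T R.

Definition density mu nu : T -> \bar R :=
  'd (charge_of_finite_measure nu) '/d mu.

Definition quad_div mu nu : \bar R :=
  if `[< nu `<< mu >] then (\int[mu]_x (1 - density mu nu x) ^+ 2)%E else +oo%E.

(* The library's inverse on \bar R satisfies (+oo)^-1 = 0, so this is 0 when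
   quad_div mu nu = +oo. *)
Definition Hratio (n : nat) (psi : probability T R -> R) mu nu : \bar R :=
  ((n%:R * (psi mu - psi nu) ^+ 2)%:E / ((quad_div mu nu + 1) ^+ n - 1))%E.

(* Library measures are functions on all of [set T]; measures are distinct when
   they differ on some measurable set, which is stronger than mu <> nu. *)
Definition Hbound (n : nat) (psi : probability T R -> R)
    (P : set (probability T R)) mu : \bar R :=
  ereal_sup [set Hratio n psi mu nu | nu in
    [set nu | P nu /\ exists2 A, measurable A & mu A != nu A]].

End divergence_bound.

Section differentiable_path.
Context {disp : measure_display} {T : measurableType disp} {R : realType}.
Context {d : nat}.
Implicit Types (Theta : set 'cV[R]_d) (mus : 'cV[R]_d -> probability T R).
Implicit Types (theta a v : 'cV[R]_d) (g : T -> 'cV[R]_d).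

(* Only the values of mus on Theta matter.  The integrand makes sense when
   theta0 + t a lies in Theta and mus(theta0 + t a) has a density; both are
   required for all small t <> 0. *)
Definition L2_differentiable Theta mus theta0 g : Prop :=
  [/\ forall i, measurable_fun setT (fun x => g x i ord0),
      (\int[mus theta0]_x (((g x)^T *m g x) ord0 ord0)%:E < +oo)%E &
      forall a,
        (\forall t \near (0 : R)^',
           Theta (theta0 + t *: a) /\
           mus (theta0 + t *: a) `<< mus theta0) /\
        (\int[mus theta0]_x
           (t^-1%:E * (density (mus theta0) (mus (theta0 + t *: a)%R) x - 1)
            - ((a^T *m g x) ord0 ord0)%:E) ^+ 2)%E
          @[t --> (0 : R)^'] --> 0%E].

Definition fisher_information (mu : probability T R) g : 'M[R]_d :=
  \matrix_(i, j) \int[mu]_x (g x i ord0 * g x j ord0).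

(* Frechet differentiability relative to Theta, as Theta is not assumed to be a
   neighbourhood of theta0; v is the gradient, as a column vector. *)
Definition has_gradient_within Theta (f : 'cV[R]_d -> R) theta0 v : Prop :=
  `|th - theta0|^-1 *
    (f th - f theta0 - (v^T *m (th - theta0)) ord0 ord0)
  @[th --> within Theta theta0^'] --> (0 : R).

Definition cramer_rao_bound (fisher : 'M[R]_d) v : R :=
  (v^T *m invmx fisher *m v) ord0 ord0.

End differentiable_path.

(* Main.v *)
(** Along a line [theta0 + t a], [L^2(mu)] differentiability says that
    [(dnu_t/dmu - 1) / t] tends to [a^T g] in [L^2(mu)], so that
    [d(mu, nu_t) / t^2] tends to [a^T I a], which is positive when [a <> 0]
    since [I] is positive semidefinite and invertible.  As [(1 + q)^n - 1] is
    equivalent to [n q] at [q = 0], the ratio [H^n] tends to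
    [(psidot^T a)^2 / (a^T I a)].  By the Cauchy-Schwarz inequality for the form
    [I] this is at most [psidot^T I^-1 psidot], with equality at
    [a = I^-1 psidot]. *)
Require Import Defs.
From HB Require Import structures.
From mathcomp Require Import all_boot all_order all_algebra.
From mathcomp Require Import all_classical all_reals all_analysis.
From mathcomp Require Import measurable_realfun ring lra.

Set Implicit Arguments.
Unset Strict Implicit.
Unset Printing Implicit Defensive.

Import Order.TTheory GRing.Theory Num.Theory.
Import numFieldNormedType.Exports.

Local Open Scope classical_set_scope.
Local Open Scope ring_scope.

(** * Positive semidefinite symmetric matrices: Cauchy-Schwarz and its equality case *)

Section psd_matrix.
Context {F : realFieldType} {d : nat} (M : 'M[F]_d).
Hypothesis M_sym : M^T = M.
Hypothesis M_psd : forall u : 'cV[F]_d, 0 <= (u^T *m M *m u) ord0 ord0.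

Let qf (u v : 'cV[F]_d) := (u^T *m M *m v) ord0 ord0.

Let qfC u v : qf u v = qf v u.
Proof.
rewrite /qf -[in LHS](trmxK (u^T *m M *m v)) mxE.
by rewrite !trmx_mul trmxK M_sym mulmxA.
Qed.

Let qf_comb (s r : F) u v :
  qf (s *: u + r *: v) (s *: u + r *: v)
  = s ^+ 2 * qf u u + (s * r * qf u v) *+ 2 + r ^+ 2 * qf v v.
Proof.
have -> : qf (s *: u + r *: v) (s *: u + r *: v) =
  s * (s * qf u u + r * qf u v) + r * (s * qf v u + r * qf v v).
  have tE : (s *: u + r *: v)^T = s *: u^T + r *: v^T.
    by rewrite linearD !linearZ.
  rewrite /qf tE !mulmxDl !mulmxDr -!scalemxAl -!scalemxAr !mxE.
  by ring.
by rewrite (qfC v u); ring.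
Qed.

(** The form is nonnegative at every combination [s *: u + r *: v]; well-chosen coefficients turn
    this into the inequality. As [M] is only semidefinite here, [qf v v = 0] with [v] nonzero is a
    genuine case. *)
Lemma psd_cauchy_schwarz (u v : 'cV[F]_d) :
  (u^T *m M *m v) ord0 ord0 ^+ 2
  <= (u^T *m M *m u) ord0 ord0 * (v^T *m M *m v) ord0 ord0.
Proof.
rewrite -!/(qf _ _).
have uu := M_psd u; have vv := M_psd v; rewrite -!/(qf _ _) in uu vv.
have qge0 s r : 0 <= s ^+ 2 * qf u u + (s * r * qf u v) *+ 2 + r ^+ 2 * qf v v.
  by rewrite -qf_comb; exact: M_psd.
move: vv; rewrite le0r => /orP[/eqP vv0|vv].
  (* With [qf v v = 0] this value is a negative multiple of [qf u v ^+ 2], so [qf u v] vanishes. The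
     [+ 1] keeps the divisor positive when [qf u u = 0]. *)
  have := qge0 (- ((qf u u + 1)^-1 * qf u v)) 1.
  rewrite vv0 mulr0 addr0.
  have A1 : 0 < qf u u + 1 by lra.
  have -> : (- ((qf u u + 1)^-1 * qf u v)) ^+ 2 * qf u u +
    (- ((qf u u + 1)^-1 * qf u v) * 1 * qf u v) *+ 2 =
    - ((qf u u + 2) / (qf u u + 1) ^+ 2 * (qf u v ^+ 2)) by field; lra.
  rewrite mulr0 oppr_ge0 pmulr_rle0// divr_gt0 ?exprn_gt0//; lra.
(* Up to scaling, this combination is the component of [u] orthogonal to [v] for the form. *)
have := qge0 (qf v v) (- qf u v).
have -> : (qf v v) ^+ 2 * qf u u + (qf v v * - qf u v * qf u v) *+ 2 +
   (- qf u v) ^+ 2 * qf v v = qf v v * (qf u u * qf v v - qf u v ^+ 2) by ring.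
by rewrite pmulr_rge0// subr_ge0.
Qed.

Hypothesis M_unit : M \in unitmx.

Lemma psd_unit_gt0 (u : 'cV[F]_d) : u != 0 -> 0 < (u^T *m M *m u) ord0 ord0.
Proof.
move=> u0; rewrite lt0r M_psd andbT; apply: contra u0 => /eqP uu0.
(* If the form vanishes at [u], pairing [u] with [M *m u] bounds the squared Euclidean norm of
   [M *m u] by zero, and invertibility then gives [u = 0]. *)
have := psd_cauchy_schwarz (M *m u) u.
rewrite uu0 mulr0 -mulmxA exprn_even_le0//= => Mu0.
suff Mu : M *m u = 0 by rewrite -(mulKmx M_unit u) Mu mulmx0.
apply/matrixP => i j; rewrite [j]ord1 [RHS]mxE.
move: Mu0; rewrite mxE psumr_eq0 => [|k _]; last by rewrite mxE -expr2 sqr_ge0.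
by move=> /allP/(_ i (mem_index_enum _)); rewrite mxE -expr2 sqrf_eq0 => /eqP.
Qed.

(** Cauchy-Schwarz for [invmx M *m v] and [a]: pairing the former with [a] through [M] gives
    [v^T *m a]. *)
Lemma psd_unit_le_inv (v a : 'cV[F]_d) : a != 0 ->
  (v^T *m a) ord0 ord0 ^+ 2 / (a^T *m M *m a) ord0 ord0
  <= (v^T *m invmx M *m v) ord0 ord0.
Proof.
move=> a0; rewrite ler_pdivrMr ?psd_unit_gt0//.
have := psd_cauchy_schwarz (invmx M *m v) a.
rewrite trmx_mul trmx_inv M_sym -(mulmxA _ (invmx M) M) mulVmx// mulmx1.
by rewrite mulmxA.
Qed.

Lemma psd_unit_inv_attained (v : 'cV[F]_d) : (0 < d)%N ->
  exists2 a : 'cV[F]_d, a != 0 &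
    (v^T *m a) ord0 ord0 ^+ 2 / (a^T *m M *m a) ord0 ord0
    = (v^T *m invmx M *m v) ord0 ord0.
Proof.
move=> d_gt0; have [->|v0] := eqVneq v 0.
  (* For [v = 0] both sides are zero in any direction, so any nonzero vector will do. *)
  exists (const_mx 1); last by rewrite trmx0 !mul0mx mxE expr0n/= mul0r.
  apply/eqP => /matrixP/(_ (Ordinal d_gt0) ord0).
  by rewrite !mxE => /eqP; rewrite oner_eq0.
have a0 : invmx M *m v != 0.
  by apply: contra v0 => /eqP e; rewrite -(mulKVmx M_unit v) e mulmx0.
exists (invmx M *m v) => //; have := psd_unit_gt0 a0.
rewrite trmx_mul trmx_inv M_sym -(mulmxA _ (invmx M) M) mulVmx// mulmx1 mulmxA.
by move=> /lt0r_neq0 e; rewrite expr2 mulfK.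
Qed.

End psd_matrix.

(** * Convergence of squared norms from convergence in mean square *)

Section L2_convergence.
Context {disp : measure_display} {T : measurableType disp} {R : realType}.
Variable mu : {measure set T -> \bar R}.

(** Young's inequality, integrated; the free [k] lets the weight of [h] come arbitrarily close to
    1. *)
Lemma integral_sqr_le (k : R) (f h : T -> R) : 0 < k ->
  measurable_fun setT f -> measurable_fun setT h ->
  (\int[mu]_x (f x ^+ 2)%:E <=
     (1 + k)%:E * \int[mu]_x (h x ^+ 2)%:E +
     (1 + k^-1)%:E * \int[mu]_x ((f x - h x) ^+ 2)%:E)%E.
Proof.
move=> k0 mf mh.
have kV : 0 < k^-1 by rewrite invr_gt0.
have mE (u : T -> R) : measurable_fun setT u ->
    measurable_fun setT (fun x => (u x ^+ 2)%:E).
  by move=> mu_; apply/measurable_EFinP; exact: measurable_funX.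
have mZ (c : R) (u : T -> R) : measurable_fun setT u ->
    measurable_fun setT (fun x => c%:E * (u x ^+ 2)%:E)%E.
  by move=> mu_; apply: measurable_funeM; exact: mE.
have mfh : measurable_fun setT (fun x => f x - h x) by exact: measurable_funB.
have k1 : (0 <= (1 + k)%:E)%E by rewrite lee_fin; lra.
have kV1 : (0 <= (1 + k^-1)%:E)%E by rewrite lee_fin; lra.
rewrite -!ge0_integralZl//; try by [exact: mE|
  move=> x _; rewrite lee_fin sqr_ge0].
rewrite -ge0_integralD//; try by [exact: mZ|
  move=> x _; rewrite mule_ge0// lee_fin sqr_ge0].
apply: ge0_le_integral => //.
- by move=> x _; rewrite lee_fin sqr_ge0.
- exact: mE.
- by apply: emeasurable_funD; exact: mZ.
move=> x _; rewrite -!EFinM -EFinD lee_fin.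
rewrite -subr_ge0; set a := f x; set b := h x.
have -> : (1 + k) * b ^+ 2 + (1 + k^-1) * (a - b) ^+ 2 - a ^+ 2 =
    k^-1 * (a - b - k * b) ^+ 2 by field; rewrite gt_eqF.
by rewrite mulr_ge0 ?sqr_ge0// ltW.
Qed.

Context {I : Type} {F : set_system I} {FF : Filter F}.

(** [integral_sqr_le] is applied in both directions, with [f i] and [h] exchanged, which bounds the
    difference of the two integrals on either side. *)
Lemma cvg_integral_sqr (f : I -> T -> R) (h : T -> R) (G : R) :
  (\forall i \near F, measurable_fun setT (f i)) ->
  measurable_fun setT h ->
  (\int[mu]_x (h x ^+ 2)%:E = G%:E)%E ->
  (\int[mu]_x ((f i x - h x) ^+ 2)%:E)%E @[i --> F] --> 0%E ->
  (\int[mu]_x (f i x ^+ 2)%:E)%E @[i --> F] --> G%:E.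
Proof.
move=> mf mh hG /fine_cvgP[Efin /cvgrPdist_lt E0].
have G0 : 0 <= G.
  by rewrite -lee_fin -hG; apply: integral_ge0 => x _; rewrite lee_fin sqr_ge0.
have Jfin : \forall i \near F, (\int[mu]_x (f i x ^+ 2)%:E)%E \is a fin_num.
  near=> i; rewrite ge0_fin_numE; last first.
    by apply: integral_ge0 => x _; rewrite lee_fin sqr_ge0.
  have mfi : measurable_fun setT (f i) by near: i.
  have /le_lt_trans := integral_sqr_le ltr01 mfi mh; apply.
  have Efi : (\int[mu]_x ((f i x - h x) ^+ 2)%:E)%E \is a fin_num by near: i.
  by rewrite hG -(fineK Efi) -!EFinM -EFinD ltry.
apply/fine_cvgP; split => //.
apply/cvgrPdist_lt => e e0.
(* The term [k * G] costs at most [e / 4]; [k <= 1] controls [k * J] in the reverse bound, and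
   [G + 1] avoids dividing by zero. The mean-square error is then taken small relative to
   [1 + k^-1]. *)
pose k := Num.min 1 (e / 4 / (G + 1)).
have G1 : 0 < G + 1 by rewrite ltr_wpDl.
have k0 : 0 < k by rewrite lt_min ltr01 !divr_gt0.
have k1 : k <= 1 by rewrite ge_min lexx.
have kG : k * (G + 1) <= e / 4 by rewrite -ler_pdivlMr// ge_min lexx orbT.
have kV : 0 < 1 + k^-1 by rewrite addr_gt0 ?invr_gt0.
near=> i.
have mfi : measurable_fun setT (f i) by near: i.
have Efi : (\int[mu]_x ((f i x - h x) ^+ 2)%:E)%E \is a fin_num by near: i.
have Jfi : (\int[mu]_x (f i x ^+ 2)%:E)%E \is a fin_num by near: i.
have : `|0 - fine (\int[mu]_x ((f i x - h x) ^+ 2)%:E)%E| < e / 4 / (1 + k^-1).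
  by near: i; apply: E0; rewrite !divr_gt0.
rewrite sub0r normrN => /ltr_normlW; rewrite ltr_pdivlMr// mulrC.
have := integral_sqr_le k0 mfi mh; have := integral_sqr_le k0 mh mfi.
under [X in (_ + _ * X)%E]eq_integral do rewrite -sqrrN opprB.
rewrite hG -(fineK Efi) -(fineK Jfi) /=.
set E := fine _; set J := fine _.
rewrite -!EFinM -!EFinD !lee_fin; clear -k0 k1 kG e0 G0 => b1 b2 hE.
rewrite ltr_norml; apply/andP; split; nra.
Unshelve. all: by end_near. Qed.

End L2_convergence.

(** * The Fisher information as a quadratic form *)

Section fisher.
Context {disp : measure_display} {T : measurableType disp} {R : realType}.
Context {d : nat} (mu : probability T R) (g : T -> 'cV[R]_d).
Hypothesis mg : forall i, measurable_fun setT (fun x => g x i ord0).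
Hypothesis g_L2 : (\int[mu]_x (((g x)^T *m g x) ord0 ord0)%:E < +oo)%E.

Let sqE x : ((g x)^T *m g x) ord0 ord0 = \sum_i g x i ord0 ^+ 2.
Proof. by rewrite mxE; apply: eq_bigr => i _; rewrite mxE expr2. Qed.

Lemma integrable_scoreM i j :
  mu.-integrable setT (fun x => (g x i ord0 * g x j ord0)%:E).
Proof.
apply: (@le_integrable _ _ _ _ _ measurableT _
  (fun x => (((g x)^T *m g x) ord0 ord0)%:E)).
- by apply/measurable_EFinP; exact: measurable_funM.
- move=> x _; rewrite !abse_EFin lee_fin sqE [leRHS]ger0_norm; last first.
    by apply: sumr_ge0 => k _; exact: sqr_ge0.
  have le k : g x k ord0 ^+ 2 <= \sum_i g x i ord0 ^+ 2.
    rewrite (bigD1 k)//= lerDl; apply: sumr_ge0 => l _; exact: sqr_ge0.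
  have := le i; have := le j; set s := \sum__ _ => sj si.
  (* The squares of the sum and of the difference bound the product of two coordinates, in absolute
     value, by half the sum of their squares. *)
  have := sqr_ge0 (g x i ord0 + g x j ord0).
  have := sqr_ge0 (g x i ord0 - g x j ord0).
  by rewrite ler_norml => p q; apply/andP; split; nra.
- apply/integrableP; split.
    apply/measurable_EFinP; under eq_fun do rewrite sqE.
    by apply: measurable_sum => i'; exact: measurable_funX.
  under eq_integral => x _.
    rewrite abse_EFin sqE ger0_norm; last first.
      by apply: sumr_ge0 => k _; exact: sqr_ge0.
    rewrite -sqE; over.
  exact: g_L2.
Qed.

Lemma measurable_score_dir (a : 'cV[R]_d) :
  measurable_fun setT (fun x => (a^T *m g x) ord0 ord0).
Proof.
under eq_fun do rewrite mxE.
by apply: measurable_sum => i; apply: measurable_funM.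
Qed.

Lemma integral_score_dir_sqr (a : 'cV[R]_d) :
  (\int[mu]_x (((a^T *m g x) ord0 ord0) ^+ 2)%:E =
   ((a^T *m fisher_information mu g *m a) ord0 ord0)%:E)%E.
Proof.
pose c i j x := ((a i ord0 * a j ord0)%:E * (g x i ord0 * g x j ord0)%:E)%E.
have ci i j : mu.-integrable setT (c i j).
  by apply: integrableZl => //; exact: integrable_scoreM.
transitivity (\int[mu]_x (\sum_j \sum_i c i j x)%R)%E.
  apply: eq_integral => x _.
  under eq_bigr => j _ do (rewrite /c; under eq_bigr do rewrite -EFinM;
    rewrite sumEFin).
  rewrite sumEFin mxE expr2 mulr_sumr; congr (_%:E); apply: eq_bigr => j _.
  rewrite mulr_suml; apply: eq_bigr => i _; rewrite !mxE; ring.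
rewrite integral_sum// => [|j]; last exact: integrable_sum.
rewrite mxE -sumEFin; apply: eq_bigr => j _.
rewrite integral_sum// mxE mulr_suml -sumEFin; apply: eq_bigr => i _.
rewrite integralZl//; last exact: integrable_scoreM.
(* Fisher entries are real parts of extended integrals, so finiteness is what identifies the two. *)
rewrite !mxE /Rintegral mulrAC [RHS]EFinM fineK//.
by apply: integrable_fin_num => //; exact: integrable_scoreM.
Qed.

Lemma fisher_information_sym :
  (fisher_information mu g)^T = fisher_information mu g.
Proof.
apply/matrixP => i j; rewrite !mxE.
by apply: eq_Rintegral => x _; rewrite mulrC.
Qed.

Lemma fisher_information_psd (a : 'cV[R]_d) :
  0 <= (a^T *m fisher_information mu g *m a) ord0 ord0.
Proof.
rewrite -lee_fin -integral_score_dir_sqr.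
by apply: integral_ge0 => x _; rewrite lee_fin sqr_ge0.
Qed.

End fisher.

(** * Quadratic divergence under domination *)

Section quadratic_divergence.
Context {disp : measure_display} {T : measurableType disp} {R : realType}.
Implicit Types mu nu : probability T R.

Lemma densityK mu nu x : nu `<< mu ->
  (fine (density mu nu x))%:E = density mu nu x.
Proof. by move=> numu; rewrite fineK//; exact: Radon_Nikodym_fin_num. Qed.

Lemma measurable_density mu nu : nu `<< mu ->
  measurable_fun setT (density mu nu).
Proof.
by move=> numu; apply: measurable_int; exact: Radon_Nikodym_integrable.
Qed.

(** Brings the divergence to the real-valued form that [cvg_integral_sqr] handles: domination makes
    the density finite, and the square absorbs the change of sign. *)
Lemma quad_divZ mu nu (t : R) : nu `<< mu ->
  ((t ^+ 2)%:E * quad_div mu nu =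
   \int[mu]_x ((t * (fine (density mu nu x) - 1)) ^+ 2)%:E)%E.
Proof.
move=> numu; rewrite /quad_div asboolT//.
under eq_integral => x _ do rewrite -densityK// -EFinB -EFin_expe.
rewrite -ge0_integralZl//.
- by apply: eq_integral => x _; rewrite -EFinM; congr (_%:E); ring.
- apply/measurable_EFinP/measurable_funX/measurable_funB => //.
  by apply: measurableT_comp => //; exact: measurable_density.
- by move=> x _; rewrite lee_fin sqr_ge0.
- by rewrite lee_fin sqr_ge0.
Qed.

(** The density and the constant 1 have equal integrals over every measurable set, hence agree
    almost everywhere. *)
Lemma quad_div_eq0 mu nu : nu `<< mu ->
  (forall A, measurable A -> mu A = nu A) -> quad_div mu nu = 0%E.
Proof.
move=> numu eqA; rewrite /quad_div asboolT//.
have d1 : ae_eq mu setT (density mu nu) (cst 1%E).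
  apply: integral_ae_eq => //; first exact: Radon_Nikodym_integrable.
  move=> A _ mA; rewrite integral_cst// mul1e [RHS]eqA// /density.
  by rewrite -Radon_Nikodym_integral.
under eq_integral => x _ do rewrite expe2.
rewrite (ae_eq_integral (cst 0%E))// ?integral0//.
- have mB : measurable_fun setT (fun x => 1 - density mu nu x)%E.
    by apply: emeasurable_funB => //; exact: measurable_density.
  exact: emeasurable_funM.
- by apply: filterS d1 => x /(_ Logic.I) /= dx _; rewrite dx subee// mul0e.
Qed.

End quadratic_divergence.

(** * Limit of the ratio from the limits of its two ingredients *)

Section Hratio_limit.
Context {disp : measure_display} {T : measurableType disp} {R : realType}.

(* With [q = t^2 * r], the denominator [(q + 1)^n - 1] is
   [t^2 * r * \sum_(i < n) (q + 1)^i], whose last factor tends to [n]. *)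
Lemma cvg_Hratio n (psi : probability T R -> R) mu (nu : R -> probability T R)
    (c G : R) : (0 < n)%N -> 0 < G ->
  t^-1 * (psi mu - psi (nu t)) @[t --> (0 : R)^'] --> c ->
  ((t^-1 ^+ 2)%:E * quad_div mu (nu t))%E @[t --> (0 : R)^'] --> G%:E ->
  Hratio n psi mu (nu t) @[t --> (0 : R)^'] --> (c ^+ 2 / G)%:E.
Proof.
move=> n_gt0 G_gt0 psic /fine_cvgP[rfin rG].
pose r t := fine ((t^-1 ^+ 2)%:E * quad_div mu (nu t))%E.
have {}rG : r t @[t --> (0 : R)^'] --> G by exact: rG.
pose q t := t ^+ 2 * r t.
pose D t := \sum_(i < n) (q t + 1) ^+ i.
have nR_gt0 : 0 < n%:R :> R by rewrite ltr0n.
have t0 : t @[t --> (0 : R)^'] --> (0 : R) by exact: nbhs_dnbhs.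
have q0 : q t @[t --> (0 : R)^'] --> (0 : R).
  suff : q t @[t --> (0 : R)^'] --> (0 * 0 * G : R) by rewrite !mul0r.
  by apply: cvgM => //; exact: cvgM.
have Dn : D t @[t --> (0 : R)^'] --> (n%:R : R).
  have -> : (n%:R : R) = \sum_(i < n) (0 + 1) ^+ i.
    by under eq_bigr do rewrite add0r expr1n; rewrite sumr_const card_ord.
  apply: cvg_big => [|i _]; first exact: add_continuous.
  apply: (cvg_comp (fun t => q t + 1) (fun x : R => x ^+ i)).
    by apply: cvgD q0 _; exact: cvg_cst.
  exact: exprn_continuous.
have main : n%:R * (t^-1 * (psi mu - psi (nu t))) ^+ 2 / (r t * D t)
    @[t --> (0 : R)^'] --> c ^+ 2 / G.
  have -> : c ^+ 2 / G = n%:R * c ^+ 2 / (G * n%:R).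
    by field; rewrite !gt_eqF.
  apply: cvgM; last first.
    by apply: cvgV; [rewrite gt_eqF// mulr_gt0|exact: cvgM].
  by apply: cvgM; [exact: cvg_cst|exact: (cvgM psic psic)].
suff HE : \forall t \near (0 : R)^', Hratio n psi mu (nu t) =
    (n%:R * (t^-1 * (psi mu - psi (nu t))) ^+ 2 / (r t * D t))%:E.
  apply/fine_cvgP; split; first by apply: filterS HE => t ->.
  apply: cvg_trans main; apply: near_eq_cvg.
  by apply: filterS HE => t /= ->.
near=> t.
have t_neq0 : t != 0 by near: t; exact: nbhs_dnbhs_neq.
have r_gt0 : 0 < r t by near: t; exact: (cvgr_gt G).
have D_gt0 : 0 < D t by near: t; exact: (cvgr_gt n%:R).
have fint : ((t^-1 ^+ 2)%:E * quad_div mu (nu t))%E \is a fin_num by near: t.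
have t2_gt0 : 0 < t^-1 ^+ 2 by rewrite exprn_even_gt0//= invr_eq0.
have qE : quad_div mu (nu t) = (q t)%:E.
  rewrite /q EFinM fineK// muleA -EFinM -exprMn mulfV// expr1n mul1e//.
rewrite /Hratio qE -EFinD -EFin_expe -EFinB subrX1 addrK inver.
(* The extended inverse treats zero separately, so the denominator must first be shown nonzero. *)
rewrite -/(D t) gt_eqF; last by rewrite mulr_gt0// mulr_gt0// exprn_even_gt0.
rewrite -EFinM /q; congr (_%:E); field.
by rewrite t_neq0 !gt_eqF.
Unshelve. all: by end_near. Qed.

End Hratio_limit.

(** * Limits along lines through [theta0] *)

Section paths.
Context {disp : measure_display} {T : measurableType disp} {R : realType}.
Context {d : nat}.
Implicit Types (Theta : set 'cV[R]_d) (mus : 'cV[R]_d -> probability T R).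
Implicit Types (theta a v : 'cV[R]_d) (g : T -> 'cV[R]_d).

(** The difference follows the order [psi mu - psi nu] of [Hratio], hence the minus sign, which
    disappears on squaring. *)
Lemma has_gradient_within_dir Theta (f : 'cV[R]_d -> R) theta0 v a : a != 0 ->
  has_gradient_within Theta f theta0 v ->
  (\forall t \near (0 : R)^', Theta (theta0 + t *: a)) ->
  t^-1 * (f theta0 - f (theta0 + t *: a)) @[t --> (0 : R)^']
    --> - (v^T *m a) ord0 ord0.
Proof.
move=> a_neq0 fv ThetaP.
have a_gt0 : 0 < `|a| by rewrite normr_gt0.
(* Since [a != 0], the line meets [theta0] only at [t = 0], so it stays in the punctured
   neighbourhood. *)
have lim : theta0 + t *: a @[t --> (0 : R)^'] --> within Theta theta0^'.
  have cvg0 : theta0 + t *: a @[t --> (0 : R)^'] --> theta0.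
    suff : theta0 + t *: a @[t --> (0 : R)^'] --> theta0 + 0 *: a.
      by rewrite scale0r addr0.
    apply: cvgD; first exact: cvg_cst.
    by apply: cvgZr_tmp; exact: nbhs_dnbhs.
  move=> A AP.
  have {}AP : \forall x \near theta0, x != theta0 -> Theta x -> A x.
    exact: AP.
  rewrite -[nbhs _ _]/(\forall t \near (0 : R)^', A (theta0 + t *: a)).
  near=> t; have : Theta (theta0 + t *: a) by near: t.
  have : theta0 + t *: a != theta0 -> Theta (theta0 + t *: a) ->
      A (theta0 + t *: a) by near: t; exact: (cvg0 _ AP).
  move=> /[swap] ThetaT /(_ _ ThetaT); apply.
  rewrite -subr_eq0 addrAC subrr add0r scaler_eq0 negb_or a_neq0 andbT.
  by near: t; exact: nbhs_dnbhs_neq.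
have /cvgr0Pnorm_lt {}fv := cvg_comp _ _ lim fv.
apply/cvgrPdist_lt => e e_gt0; near=> t.
have t_neq0 : t != 0 by near: t; exact: nbhs_dnbhs_neq.
have t_gt0 : 0 < `|t| by rewrite normr_gt0.
have : `| `|theta0 + t *: a - theta0|^-1 *
    (f (theta0 + t *: a) - f theta0 -
     (v^T *m (theta0 + t *: a - theta0)) ord0 ord0)| < e / `|a|.
  by near: t; apply: fv; exact: divr_gt0.
have -> : theta0 + t *: a - theta0 = t *: a by rewrite addrAC subrr add0r.
have -> : (v^T *m (t *: a)) ord0 ord0 = t * (v^T *m a) ord0 ord0.
  by rewrite -scalemxAr mxE.
rewrite ltr_pdivlMr//; set w := (v^T *m a) _ _; set D := f _ - f _ - _.
have -> : - w - t^-1 * (f theta0 - f (theta0 + t *: a)) = t^-1 * D.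
  by rewrite /D; field.
rewrite !(normrM, normfV, normr_id).
have -> : `|t *: a| = `|t| * `|a| by rewrite normrZ.
suff -> : (`|t| * `|a|)^-1 * `|D| * `|a| = `|t|^-1 * `|D| by [].
by field; rewrite !gt_eqF.
Unshelve. all: by end_near. Qed.

Lemma cvg_quad_div_dir Theta mus theta0 g a :
  L2_differentiable Theta mus theta0 g ->
  ((t^-1 ^+ 2)%:E * quad_div (mus theta0) (mus (theta0 + t *: a)%R))%E
    @[t --> (0 : R)^'] -->
  ((a^T *m fisher_information (mus theta0) g *m a) ord0 ord0)%:E.
Proof.
move=> [mg g_L2 /(_ a) [ThetaP cvg_a]].
pose r t x :=
  t^-1 * (fine (density (mus theta0) (mus (theta0 + t *: a)) x) - 1).
have dom : \forall t \near (0 : R)^', mus (theta0 + t *: a) `<< mus theta0.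
  by apply: filterS ThetaP => t [].
have rP : (\int[mus theta0]_x ((r t x) ^+ 2)%:E)%E @[t --> (0 : R)^'] -->
    ((a^T *m fisher_information (mus theta0) g *m a) ord0 ord0)%:E.
  apply: (cvg_integral_sqr (h := fun x => (a^T *m g x) ord0 ord0)).
  - apply: filterS dom => t numu; apply: measurable_funM => //.
    apply: measurable_funB => //; apply: measurableT_comp => //.
    exact: measurable_density.
  - exact: measurable_score_dir.
  - exact: integral_score_dir_sqr.
  - apply: cvg_trans cvg_a; apply: near_eq_cvg.
    apply: filterS dom => t numu; apply: eq_integral => x _.
    by rewrite -densityK// -EFinB -EFinM -EFinB -EFin_expe.
apply: cvg_trans rP; apply: near_eq_cvg.
by apply: filterS dom => t numu; rewrite quad_divZ.
Qed.

Lemma cvg_Hratio_dir Theta mus theta0 g (psi : probability T R -> R) v a n :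
  L2_differentiable Theta mus theta0 g ->
  fisher_information (mus theta0) g \in unitmx ->
  has_gradient_within Theta (fun theta => psi (mus theta)) theta0 v ->
  (0 < n)%N -> a != 0 ->
  Hratio n psi (mus theta0) (mus (theta0 + t *: a)) @[t --> (0 : R)^'] -->
  ((v^T *m a) ord0 ord0 ^+ 2 /
   (a^T *m fisher_information (mus theta0) g *m a) ord0 ord0)%:E.
Proof.
move=> L2 Iunit psiv n_gt0 a_neq0; have [mg g_L2 /(_ a) [ThetaP _]] := L2.
rewrite -sqrrN; apply: cvg_Hratio => //.
- apply: psd_unit_gt0 => //; first exact: fisher_information_sym.
  exact: fisher_information_psd.
- apply: has_gradient_within_dir a_neq0 psiv _.
  by apply: filterS ThetaP => t [].
- exact: cvg_quad_div_dir L2.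
Qed.

(** The rescaled divergence has a positive limit, whereas it would be zero if the measures agreed on
    measurable sets. This places nearby points of the line in the index set of [Hbound]. *)
Lemma near_path_neq Theta mus theta0 g a :
  L2_differentiable Theta mus theta0 g ->
  fisher_information (mus theta0) g \in unitmx -> a != 0 ->
  \forall t \near (0 : R)^', Theta (theta0 + t *: a) /\
    exists2 A, measurable A & mus theta0 A != mus (theta0 + t *: a) A.
Proof.
move=> L2 Iunit a_neq0; have [mg g_L2 /(_ a) [ThetaP _]] := L2.
have G_gt0 := psd_unit_gt0 (fisher_information_sym _ g)
  (fisher_information_psd mg g_L2) Iunit a_neq0.
have /fine_cvgP[_ /cvgr_gt/(_ _ G_gt0)/= q_gt0] :=
  cvg_quad_div_dir (a := a) L2.
near=> t; have [Thetat numu] : Theta (theta0 + t *: a) /\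
  mus (theta0 + t *: a) `<< mus theta0 by near: t.
split=> //; apply: contrapT => nA.
have : 0 < fine ((t^-1 ^+ 2)%:E *
    quad_div (mus theta0) (mus (theta0 + t *: a)%R))%E by near: t.
rewrite quad_div_eq0// ?mule0 ?ltxx// => A mA.
by apply/eqP; apply: contrapT => /negP neA; apply: nA; exists A.
Unshelve. all: by end_near. Qed.

End paths.

(* For d >= 2 the ratio has no limit as theta tends freely to theta0: for the
   model N(theta, I_2) with psi = theta_1 it vanishes on the axis theta_1 = 0,
   while the Cramer-Rao bound is 1.  The limit is then taken along lines through
   theta0, and the bound is the one along the least favourable line. *)
Theorem proposition2p2 (R : realType) (p d : nat) (X : set 'cV[R]_p) (x0 : X)
  (Theta : set 'cV[R]_d) (theta0 : 'cV[R]_d)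
  (mus : 'cV[R]_d -> probability (borel_subspace X x0) R)
  (g : borel_subspace X x0 -> 'cV[R]_d)
  (psi : probability (borel_subspace X x0) R -> R) (psidot : 'cV[R]_d) :
  open X ->
  (0 < d)%N ->
  Theta theta0 ->
  L2_differentiable Theta mus theta0 g ->
  fisher_information (mus theta0) g \in unitmx ->
  has_gradient_within Theta (fun theta => psi (mus theta)) theta0 psidot ->
  let mu := mus theta0 in
  let B := cramer_rao_bound (fisher_information mu g) psidot in
  forall n : nat, (0 < n)%N ->
  [/\ d = 1%N ->
        Hratio n psi mu (mus theta) @[theta --> within Theta theta0^']
          --> B%:E,
      exists2 a : 'cV[R]_d, a != 0 &
        Hratio n psi mu (mus (theta0 + t *: a)) @[t --> (0 : R)^'] --> B%:E,
      forall a : 'cV[R]_d, a != 0 ->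
        exists2 l : R, l <= B &
          Hratio n psi mu (mus (theta0 + t *: a)) @[t --> (0 : R)^'] --> l%:E &
      (B%:E <= Hbound n psi (mus @` Theta) mu)%E].
Proof.
move=> _ d_gt0 _ L2 Iunit psiv mu B n n_gt0.
have [mg g_L2 _] := L2.
have Isym := fisher_information_sym mu g.
have Ipsd := fisher_information_psd mg g_L2.
have [a a_neq0 aB] := psd_unit_inv_attained Isym Ipsd Iunit psidot d_gt0.
have limB : Hratio n psi mu (mus (theta0 + t *: a)) @[t --> (0 : R)^']
    --> B%:E.
  by rewrite /B /cramer_rao_bound -aB; exact: cvg_Hratio_dir L2 _ psiv _ _.
split.
- move=> d1; subst d.
  have a00 : a 0 0 != 0.
    apply: contra a_neq0 => /eqP a00.
    by apply/eqP/matrixP => i j; rewrite !ord1 mxE.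
  (* In dimension one every [theta] lies on the line through [theta0] directed by [a]; [coord] is
     its parameter there, so the free limit reduces to the directional one. *)
  pose coord (theta : 'cV[R]_1) := (theta 0 0 - theta0 0 0) / a 0 0.
  have pathE theta : theta0 + coord theta *: a = theta.
    by apply/matrixP => i j; rewrite !ord1 /coord !mxE divfK // addrC subrK.
  have cvg_coord : coord theta @[theta --> within Theta theta0^'] --> (0 : R)^'.
    have cvg0 : continuous coord.
      move=> theta.
      apply: (@cvgMr_tmp _ _ (nbhs theta) _ (fun th => th 0 0 - theta0 0 0)).
      apply: (@cvgB _ _ _ (nbhs theta) _ (fun th => th 0 0)).
        exact: coord_continuous.
      exact: cvg_cst.
    move=> U UP; have {}UP : \forall x \near coord theta0, x != 0 -> U x.
      by rewrite /coord subrr mul0r; exact: UP.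
    rewrite -[nbhs _ _]/(\forall theta \near theta0,
      theta != theta0 -> Theta theta -> U (coord theta)).
    have {}UP : \forall theta \near theta0, coord theta != 0 -> U (coord theta).
      exact: (cvg0 _ _ UP).
    apply: filterS UP => theta /= Utheta neq _; apply: Utheta.
    by apply: contra neq => /eqP c0; rewrite -(pathE theta) c0 scale0r addr0.
  under eq_fun do rewrite -[X in mus X]pathE.
  exact: cvg_comp cvg_coord limB.
- by exists a.
- move=> b b_neq0; exists ((psidot^T *m b) ord0 ord0 ^+ 2 /
    (b^T *m fisher_information mu g *m b) ord0 ord0).
    exact: (psd_unit_le_inv Isym Ipsd Iunit psidot b_neq0).
  exact: cvg_Hratio_dir L2 _ psiv _ _.
(* For small [t] each ratio along the optimal line is a term of the supremum, and the bound passes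
   to the limit. *)
- apply: (cvge_to_le limB).
  apply: filterS (near_path_neq L2 Iunit a_neq0) => t [Thetat neq].
  by apply: ereal_sup_ubound; exists (mus (theta0 + t *: a)) => //; split.
Qed.
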